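(* A lattice simplex $\Delta$ is thin if and only if the corresponding linear code $C_\Delta$ is thin, i.e. if and only if $C_\Delta$ contains no word all of whose $d+1$ entries are nonzero (where $d=\dim\Delta$).
   Context: Let $M\cong\mathbb{Z}^d$ be a lattice and $\Delta$ a $d$-dimensional lattice simplex in $M\otimes\mathbb{R}$ with vertices $v_0,\dots,v_d\in M$. Local $h^*$-polynomial: $l^*(\Delta,t)=\sum_{\emptyset\subseteq F\subseteq\Delta}(-1)^{\dim\Delta-\dim F}h^*(F,t)$ (sum over all faces, with $\dim\emptyset=-1$, $h^*(\emptyset,t)=1$); equivalently $l^*(\Delta,t)=\sum_{\lambda}t^{\lambda_{d+1}}$, the sum being over the points $\lambda\in M\oplus\mathbb{Z}$ in the open parallelepiped $\Pi_\Delta^\circ=\{\sum_{i=0}^d a_i(v_i,1):0<a_i<1\}$, where $\lambda_{d+1}$ is the last coordinate. $\Delta$ is called thin if $l^*(\Delta,t)=0$. Code of a simplex: $\mathbb{Z}_N=\mathbb{Z}/N\mathbb{Z}$, with elements identified with $0,\dots,N-1$. Let $\Lambda_\Delta=\{x\in(\mathbb{R}/\mathbb{Z})^{d+1}:\sum_i\{x_i\}(v_i,1)\in M\oplus\mathbb{Z}\}$, where $\{\cdot\}$ is the fractional part. $N_\Delta$ is the least common multiple of the denominators of all coordinates of elements of $\Lambda_\Delta$, and $C_\Delta=\{(N_\Delta\{x_0\},\dots,N_\Delta\{x_d\}):x\in\Lambda_\Delta\}\subseteq\mathbb{Z}_{N_\Delta}^{d+1}$, a $\mathbb{Z}_{N_\Delta}$-submodule.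 A linear code $C\subseteq\mathbb{Z}_N^n$ is extended if every word has coordinate sum $0\bmod N$ ($C_\Delta$ is extended), and an extended code is thin if it has no word with all $n$ entries nonzero. *)

(* Defs.v *)
From HB Require Import structures.
From mathcomp Require Import all_boot all_order all_algebra finmap.
From mathcomp Require Import all_classical all_reals.

Set Implicit Arguments.
Unset Strict Implicit.
Unset Printing Implicit Defensive.

Import Order.TTheory GRing.Theory Num.Theory.
Local Open Scope classical_set_scope.
Local Open Scope ring_scope.

(* A lattice of rank d is an additive group M with a bijective additive map
   phi : M -> Z^d; M (x) R is identified with R^d, the embedding of M being
   [realpt phi]. *)
Definition realpt (R : realType) (d : nat) (M : zmodType)
    (phi : {additive M -> 'rV[int]_d}) (m : M) : 'rV[R]_d :=
  map_mx intr (phi m).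

(* The point (m, k) of (M (+) Z) (x) R = R^(d+1). *)
Definition lift_pt (R : realType) (d : nat) (M : zmodType)
    (phi : {additive M -> 'rV[int]_d}) (m : M) (k : int) : 'rV[R]_(d + 1) :=
  row_mx (realpt R phi m) (const_mx k%:~R).

Definition affinely_independent (R : realType) (d n : nat)
    (p : 'I_n -> 'rV[R]_d) : Prop :=
  forall a : 'I_n -> R,
    \sum_i a i = 0 -> \sum_i a i *: p i = 0 -> forall i, a i = 0.

(* The faces of the simplex with vertices v are the convex hulls of the
   subfamilies (v_i)_(i in S); S = 0 gives the empty face, and the dimension
   of the face is #|S| - 1. *)
Definition face (R : realType) (d n : nat) (p : 'I_n -> 'rV[R]_d)
    (S : {set 'I_n}) : set 'rV[R]_d :=
  [set x | exists a : 'I_n -> R,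
    [/\ forall i, 0 <= a i, forall i, i \notin S -> a i = 0,
        \sum_i a i = 1 & x = \sum_i a i *: p i]].

Definition ehrhart (R : realType) (d : nat) (M : zmodType)
    (phi : {additive M -> 'rV[int]_d}) (P : set 'rV[R]_d) (k : nat) : nat :=
  #|` fset_set [set m : M | exists2 x, P x & realpt R phi m = k%:R *: x] |.

(* For P of dimension r - 1, the polynomial h^*(P, t) such that
   h^*(P, t) = (1 - t)^r * \sum_(k >= 0) |kP n M| t^k
   as formal power series. *)
Definition hstar_nonempty (R : realType) (d : nat) (M : zmodType)
    (phi : {additive M -> 'rV[int]_d}) (P : set 'rV[R]_d) (r : nat)
    : {poly int} :=
  xget 0 [set h : {poly int} | forall n : nat,
    h`_n = \sum_(i < n.+1) ((1 - 'X) ^+ r)`_i * (ehrhart phi P (n - i))%:R].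

Definition hstar_face (R : realType) (d n : nat) (M : zmodType)
    (phi : {additive M -> 'rV[int]_d}) (v : 'I_n -> M) (S : {set 'I_n})
    : {poly int} :=
  if #|S| == 0%N then 1
  else hstar_nonempty phi (face (fun i => realpt R phi (v i)) S) #|S|.

(* dim Delta - dim F = d - (#|S| - 1) = d + 1 - #|S|. *)
Definition local_hstar (R : realType) (d : nat) (M : zmodType)
    (phi : {additive M -> 'rV[int]_d}) (v : 'I_d.+1 -> M) : {poly int} :=
  \sum_(S : {set 'I_d.+1}) (-1) ^+ (d.+1 - #|S|) * hstar_face R phi v S.

Definition thin_simplex (R : realType) (d : nat) (M : zmodType)
    (phi : {additive M -> 'rV[int]_d}) (v : 'I_d.+1 -> M) : Prop :=
  local_hstar R phi v = 0.

Definition frac_part (R : realType) (x : R) : R := x - (Num.floor x)%:~R.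

(* An element of (R/Z)^(d+1) is given by an arbitrary representative x in
   R^(d+1); everything below depends on x only through the frac_part (x i). *)
Definition Lambda (R : realType) (d : nat) (M : zmodType)
    (phi : {additive M -> 'rV[int]_d}) (v : 'I_d.+1 -> M)
    : set ('I_d.+1 -> R) :=
  [set x | exists (m : M) (k : int),
    \sum_i frac_part (x i) *: lift_pt R phi (v i) 1 = lift_pt R phi m k].

Definition denominators (R : realType) (d : nat) (M : zmodType)
    (phi : {additive M -> 'rV[int]_d}) (v : 'I_d.+1 -> M) : set nat :=
  [set n | exists x : 'I_d.+1 -> R, Lambda phi v x /\
    exists (i : 'I_d.+1) (q : rat),
      frac_part (x i) = ratr q /\ n = absz (denq q)].

Definition N_simplex (R : realType) (d : nat) (M : zmodType)
    (phi : {additive M -> 'rV[int]_d}) (v : 'I_d.+1 -> M) : nat :=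
  \big[lcmn/1%N]_(n <- fset_set (denominators R phi v)) n.

(* Z/NZ with elements 0, ..., N-1, for N >= 1. Not 'Z_N, which is Z/2Z when
   N = 1 (a case that does occur: unimodular simplices). *)
Notation Zmod N := 'I_N.-1.+1.

Definition linear_code (N n : nat) (C : set 'rV[Zmod N]_n) : Prop :=
  [/\ C 0, forall u w, C u -> C w -> C (u + w) &
      forall (a : Zmod N) u, C u -> C (u *+ a)].

Definition extended_code (N n : nat) (C : set 'rV[Zmod N]_n) : Prop :=
  forall w, C w -> \sum_i w 0 i = 0.

Definition has_full_word (N n : nat) (C : set 'rV[Zmod N]_n) : Prop :=
  exists w, C w /\ forall i, w 0 i != 0.

Definition thin_code (N n : nat) (C : set 'rV[Zmod N]_n) : Prop :=
  [/\ linear_code C, extended_code C & ~ has_full_word C].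

Definition code_simplex (R : realType) (d : nat) (M : zmodType)
    (phi : {additive M -> 'rV[int]_d}) (v : 'I_d.+1 -> M)
    : set 'rV[Zmod (N_simplex R phi v)]_d.+1 :=
  [set w : 'rV[Zmod (N_simplex R phi v)]_d.+1 |
    exists x : 'I_d.+1 -> R, Lambda phi v x /\
    forall i, (w 0 i : nat)%:R = (N_simplex R phi v)%:R * frac_part (x i)].

Arguments code_simplex R {d M} phi v _.

(* Main.v *)
(* Write the lattice points of the cone over Delta in barycentric coordinates
   a_i >= 0, their height being the sum of the a_i.  Multiplying the Ehrhart
   series of a face S by (1 - t)^#|S| = \sum_(T \subset S) (-t)^#|T| removes, by
   inclusion-exclusion and translation by the vertices of T, the points having
   some a_i >= 1; so h^*(S, t) counts the points with 0 <= a_i < 1 supported in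
   S.  A second inclusion-exclusion over S leaves in l^*(Delta, t) the points
   with all 0 < a_i < 1.  No cancellation can occur, so Delta is thin iff there
   is no such point, and these points are the full words of C_Delta divided by
   N_Delta. *)
Require Import Defs.
From HB Require Import structures.
From mathcomp Require Import all_boot all_order all_algebra finmap ring lra.
From mathcomp Require Import all_classical all_reals.

Set Implicit Arguments.
Unset Strict Implicit.
Unset Printing Implicit Defensive.

Import Order.TTheory GRing.Theory Num.Theory.
Local Open Scope classical_set_scope.
Local Open Scope ring_scope.


(** * Signed sums over subsets *)

(** The power becomes a product over all of [I] whose factors outside [S] are [0 + 1]. Expanding it
    gives one term per subset, and the subsets not inside [S] contribute 0. *)
Lemma sum_expr_subset (A : comNzRingType) (I : finType) (S : {set I}) (x : A) :
  \sum_(T : {set I} | T \subset S) x ^+ #|T| = (1 + x) ^+ #|S|.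
Proof.
rewrite -prodr_const [RHS](eq_bigr (fun=> x + 1)) => [|i _]; last exact: addrC.
rewrite [RHS]big_mkcond /=
  [RHS](eq_bigr (fun i => (if i \in S then x else 0) + 1)) /=; last first.
  by move=> i _; case: ifP => //; rewrite add0r.
rewrite [RHS]bigA_distr [LHS]big_mkcond /=; apply: eq_bigr => T _.
case: ifP => [/fintype.subsetP TS|/negbT/subsetPn[i iT iS]].
  rewrite -prodr_const [LHS]big_mkcond /=; apply: eq_bigr => i _.
  by case: ifP => // /TS ->.
by rewrite (bigD1 i) //= iT (negbTE iS) mul0r.
Qed.

Lemma sum_sign_subset (I : finType) (S : {set I}) :
  \sum_(T : {set I} | T \subset S) (-1) ^+ #|T| = (S == finset.set0)%:R :> int.
Proof. by rewrite sum_expr_subset subrr expr0n cards_eq0. Qed.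

(** Complementation turns supersets of [S] into subsets of its complement. *)
Lemma sum_sign_superset (I : finType) (S : {set I}) :
  \sum_(T : {set I} | S \subset T) (-1) ^+ (#|I| - #|T|) = (S == [set: I]%SET)%:R :> int.
Proof.
rewrite (reindex_inj (@finset.setC_inj _)) /= -(finset.setCK S).
under eq_bigl do rewrite finset.setCS.
rewrite (eq_bigr (fun T : {set I} => (-1) ^+ #|T|)) => [|T _].
  by rewrite sum_sign_subset finset.setCK
    -(inj_eq (@finset.setC_inj _)) finset.setCK finset.setC0.
by rewrite -cardsCs.
Qed.

(** * Barycentric coordinates of lattice points in the cone over the simplex *)

Section SimplexPoints.

Variables (R : realType) (d : nat) (M : zmodType).
Variables (phi : {additive M -> 'rV[int]_d}) (v : 'I_d.+1 -> M).
Hypothesis phi_bij : bijective phi.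
Hypothesis v_simplex : affinely_independent (fun i => realpt R phi (v i)).

Local Notation pt := (realpt R phi).

Lemma realptD m m' : pt (m + m') = pt m + pt m'.
Proof. by rewrite /realpt raddfD map_mxD. Qed.

Lemma realptMz m (z : int) : pt (m *~ z) = z%:~R *: pt m.
Proof. by apply/rowP => j; rewrite /realpt raddfMz !mxE -scaler_int !mxE intrM intz. Qed.

Lemma realpt0 : pt 0 = 0.
Proof. by rewrite /realpt raddf0 map_mx0. Qed.

Lemma realpt_sum (I : Type) (r : seq I) (P : pred I) (f : I -> M) :
  pt (\sum_(i <- r | P i) f i) = \sum_(i <- r | P i) pt (f i).
Proof.
exact: (big_morph pt realptD realpt0).
Qed.

Lemma realpt_inj : injective pt.
Proof.
move=> m m' /rowP mm'; apply: (bij_inj phi_bij); apply/rowP => j.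
by have := mm' j; rewrite !mxE => /intr_inj.
Qed.

Definition barycentric (a : 'I_d.+1 -> R) (k : nat) (m : M) : Prop :=
  \sum_i a i = k%:R /\ \sum_i a i *: pt (v i) = pt m.

Definition dilate (k : nat) : set M :=
  [set m | exists a, (forall i, 0 <= a i) /\ barycentric a k m].

(** The default is harmless: [coef] is only evaluated where coordinates exist, and affine
    independence makes them unique. *)
Definition coef (k : nat) (m : M) : 'I_d.+1 -> R :=
  xget (fun=> 0) [set a | barycentric a k m].

Lemma barycentric_inj a b k m :
  barycentric a k m -> barycentric b k m -> a = b.
Proof.
move=> [sa pa] [sb pb]; apply/funext => i; apply/eqP; rewrite -subr_eq0; apply/eqP.
apply: (v_simplex (a := fun i => a i - b i)).
  by rewrite sumrB sa sb subrr.
under eq_bigr do rewrite scalerBl.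
by rewrite sumrB pa pb subrr.
Qed.

Lemma barycentric_pt_inj a k m m' :
  barycentric a k m -> barycentric a k m' -> m = m'.
Proof. by move=> [_ pa] [_]; rewrite pa => /realpt_inj. Qed.

Lemma coefE a k m : barycentric a k m -> coef k m = a.
Proof. by move=> am; apply: xget_unique => // b /barycentric_inj; apply. Qed.

Lemma dilate_coef k m : dilate k m ->
  (forall i, 0 <= coef k m i) /\ barycentric (coef k m) k m.
Proof. by move=> [a [a0 am]]; rewrite (coefE am). Qed.

(** Nonnegative coordinates with sum [k] are each at most [k], which bounds every entry of [phi m]
    by [B]. The integer vectors with entries between [-B] and [B] are finitely many, and [phi] is
    injective. *)
Lemma finite_dilate k : finite_set (dilate k).
Proof.
pose B : int := k%:Z * \sum_i \sum_j `|phi (v i) 0 j|.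
have B0 : 0 <= B by rewrite mulr_ge0 // sumr_ge0 // => i _; rewrite sumr_ge0.
pose f (u : 'rV['I_(absz B).*2.+1]_d) : 'rV[int]_d :=
  map_mx (fun i : 'I__ => i%:Z - B) u.
case: phi_bij => psi phiK psiK.
apply: (@sub_finite_set _ _ (range (psi \o f))); last first.
  by apply: finite_image; exact: finite_finset.
move=> m [a [a0 [sa pa]]].
have bnd j : `|phi m 0 j| <= B.
  rewrite -(@ler_int R) intr_norm.
  have -> : (phi m 0 j)%:~R = pt m 0 j by rewrite mxE.
  rewrite -pa summxE (le_trans (ler_norm_sum _ _ _)) //.
  rewrite /B intrM rmorph_sum /= mulr_sumr ler_sum // => i _.
  rewrite !mxE normrM ger0_norm //.
  apply: ler_pM => //.
    by rewrite -pmulrn -sa (bigD1 i) //= lerDl sumr_ge0.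
  rewrite -intr_norm ler_int (bigD1 j) //= lerDl sumr_ge0 //.
exists (\row_j inord (absz (phi m 0 j + B))) => //=.
rewrite -[RHS]phiK; congr psi; apply/rowP => j; rewrite !mxE.
have := bnd j; rewrite ler_norml => /andP[h1 h2].
rewrite inordK; first by rewrite gez0_abs ?addrK // -lerBlDr sub0r.
rewrite ltnS -lez_nat gez0_abs -?lerBlDr ?sub0r //.
by rewrite -addnn PoszD gez0_abs // lerD2r.
Qed.

(** * Ehrhart counting by support, and translation by vertices *)

Definition supp k m : {set 'I_d.+1} := [set i | coef k m i != 0]%SET.

Definition large k m : {set 'I_d.+1} := [set i | 1 <= coef k m i]%SET.

Definition points k : {fset M} := fset_set (dilate k).

Lemma in_points k m : (m \in points k) = `[< dilate k m >].
Proof. by rewrite /points in_fset_set ?mem_setE //; exact: finite_dilate. Qed.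

(** Scaling by [k] matches points of the face with cone points of height [k] supported in [S].
    Nonemptiness of [S] matters at [k = 0], where some point of the face must be multiplied by 0. *)
Lemma ehrhart_face (S : {set 'I_d.+1}) k : (0 < #|S|)%N ->
  ehrhart phi (face (fun i => pt (v i)) S) k =
  \sum_(m <- points k | supp k m \subset S) 1%N.
Proof.
move=> /card_gt0P[i0 i0S].
rewrite /ehrhart -big_filter sum1_size.
set A := [set m | _].
have AE m : A m <-> dilate k m /\ supp k m \subset S.
  split=> [[x [a [a0 aS sa ->]] mx]|[/dilate_coef[a0 [sa pa]] /fintype.subsetP sS]].
    have bm : barycentric (fun i => k%:R * a i) k m.
      split; first by rewrite -mulr_sumr sa mulr1.
      by rewrite mx scaler_sumr; apply: eq_bigr => i _; rewrite scalerA.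
    split; first by exists (fun i => k%:R * a i); split=> // i; rewrite mulr_ge0.
    apply/fintype.subsetP => i; rewrite inE (coefE bm).
    by apply: contraR => /aS ->; rewrite mulr0.
  have aS i : i \notin S -> coef k m i = 0.
    by move=> iS; apply/eqP; apply: contraNT iS => ai; apply: sS; rewrite inE.
  rewrite {}/A /=; case: k a0 sa pa aS sS => [|k] a0 sa pa aS _.
    (* At height 0 the coordinates cannot be divided by [k]. They all vanish, so [m] is the origin
       and any vertex of the face serves. *)
    exists (pt (v i0)); last first.
      rewrite scale0r -pa big1 // => i _.
      have /eqP : \sum_i coef 0 m i = 0 by [].
      by rewrite psumr_eq0 // => /allP/(_ i (mem_index_enum _))/eqP ->; rewrite scale0r.
    exists (fun i => (i == i0)%:R); split.
    - by move=> i; exact: ler0n.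
    - by move=> i; case: eqP => // ->; rewrite i0S.
    - by rewrite (bigD1 i0) //= eqxx big1 ?addr0 // => i /negbTE ->.
    - by rewrite (bigD1 i0) //= eqxx scale1r big1 ?addr0 // => i /negbTE ->;
      rewrite scale0r.
  have k0 : k.+1%:R != 0 :> R by rewrite pnatr_eq0.
  exists (\sum_i (k.+1%:R^-1 * coef k.+1 m i) *: pt (v i)).
    exists (fun i => k.+1%:R^-1 * coef k.+1 m i); split=> //.
    - by move=> i; rewrite mulr_ge0 // invr_ge0.
    - by move=> i /aS ->; rewrite mulr0.
    - by rewrite -mulr_sumr sa mulVf.
  rewrite -pa scaler_sumr; apply: eq_bigr => i _.
  by rewrite scalerA mulrA divff // mul1r.
have finA : finite_set A.
  by apply: sub_finite_set (finite_dilate k) => m /AE[].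
apply: perm_size; apply: uniq_perm; rewrite ?filter_uniq ?fset_uniq // => m.
rewrite mem_filter in_fset_set // in_points; apply/idP/andP.
  by rewrite inE => /AE[Dm ->]; split=> //; apply/asboolP.
by move=> [? /asboolP Dm]; rewrite inE; apply/AE.
Qed.

(** Adding the vertices indexed by [T] raises these coordinates by 1 and the height by [#|T|]. It is
    a bijection onto the points whose coordinates in [T] are at least 1, with subtraction as
    inverse. *)
Lemma sum_points_shift (S T : {set 'I_d.+1}) k n : T \subset S ->
  n = (k + #|T|)%N ->
  \sum_(m <- points k | supp k m \subset S) 1%N =
  \sum_(m <- points n | (supp n m \subset S) && (T \subset large n m)) 1%N.
Proof.
move=> TS ->{n}; set n := (k + #|T|)%N.
pose w := \sum_(i in T) v i.
have shiftP (a b : 'I_d.+1 -> R) m : (forall i, b i = a i + (i \in T)%:R) ->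
    barycentric a k m <-> barycentric b n (m + w).
  move=> ba; rewrite /barycentric realptD realpt_sum.
  have -> : \sum_i b i = \sum_i a i + #|T|%:R.
    rewrite (eq_bigr _ (fun i _ => ba i)) big_split /=; congr (_ + _).
    by rewrite -natr_sum -big_mkcond sum1_card.
  have -> : \sum_i b i *: pt (v i) = \sum_i a i *: pt (v i) + \sum_(i in T) pt (v i).
    rewrite (eq_bigr (fun i => a i *: pt (v i) + (i \in T)%:R *: pt (v i))) => [|i _].
      rewrite big_split /= [in RHS](big_mkcond (mem T)); congr (_ + _).
      by apply: eq_bigr => i _; rewrite /=; case: (i \in T); rewrite ?scale1r ?scale0r.
    by rewrite ba scalerDl.
  rewrite /n natrD.
  by split=> -[s p]; split; [rewrite s|rewrite p|exact: addIr s|exact: addIr p].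
rewrite -big_filter -[RHS]big_filter !sum1_size.
rewrite -(size_map (fun m => m + w)); apply: perm_size; apply: uniq_perm.
- by rewrite (map_inj_uniq (addIr w)) filter_uniq ?fset_uniq.
- by rewrite filter_uniq ?fset_uniq.
move=> m'; apply/mapP/idP => [[m]|].
  rewrite mem_filter in_points => /andP[/fintype.subsetP mS /asboolP].
  move=> /dilate_coef[c0 cm] ->.
  pose b i := coef k m i + (i \in T)%:R.
  have bm : barycentric b n (m + w) by apply/(shiftP (coef k m)).
  rewrite mem_filter in_points; apply/andP; split; last first.
    by apply/asboolP; exists b; split=> // i; rewrite addr_ge0.
  apply/andP; split; apply/fintype.subsetP => i; rewrite inE (coefE bm) /b.
    have [/(fintype.subsetP TS) -> //|iT] := boolP (i \in T).
    by rewrite addr0 => ci; apply: mS; rewrite inE.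
  by move=> ->; rewrite lerDr.
rewrite mem_filter in_points => /andP[/andP[/fintype.subsetP mS /fintype.subsetP mT]].
move=> /asboolP/dilate_coef[c0 cm].
exists (m' - w); last by rewrite subrK.
pose a i := coef n m' i - (i \in T)%:R.
have am : barycentric a k (m' - w).
  apply/(shiftP a (coef n m')); first by move=> i; rewrite subrK.
  by rewrite subrK.
rewrite mem_filter in_points; apply/andP; split.
  apply/fintype.subsetP => i; rewrite inE (coefE am) /a.
  have [/(fintype.subsetP TS) -> //|iT] := boolP (i \in T).
  by rewrite subr0 => ci; apply: mS; rewrite inE.
apply/asboolP; exists a; split=> // i; rewrite /a.
have [/mT|_] := boolP (i \in T); last by rewrite subr0.
by rewrite inE subr_ge0.
Qed.

Lemma large_sub_supp k m : large k m \subset supp k m.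
Proof.
apply/fintype.subsetP => i; rewrite !inE => h.
by rewrite gt_eqF // (lt_le_trans ltr01).
Qed.

Lemma card_large k m : dilate k m -> (#|large k m| <= k)%N.
Proof.
move=> /dilate_coef[c0 [sc _]]; rewrite -(@ler_nat R) -sc.
rewrite -sum1_card natr_sum [leRHS](bigID (mem (large k m))) /=.
rewrite -[leLHS]addr0 lerD ?sumr_ge0 //.
by apply: ler_sum => i; rewrite inE.
Qed.

(** * Coefficients of [hstar_face] and [local_hstar] as counts of box points *)

Definition box (S : {set 'I_d.+1}) n : int :=
  \sum_(m <- points n | (supp n m \subset S) && (large n m == finset.set0)) 1.

Lemma hstar_coef (S : {set 'I_d.+1}) n : (0 < #|S|)%N ->
  \sum_(i < n.+1) ((1 - 'X) ^+ #|S|)`_i *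
     (ehrhart phi (face (fun i => pt (v i)) S) (n - i))%:R = box S n.
Proof.
move=> S0; rewrite -sum_expr_subset.
under eq_bigr => i _ do rewrite coef_sum mulr_suml ehrhart_face //.
rewrite exchange_big /=.
transitivity (\sum_(T : {set 'I_d.+1} | T \subset S)
   \sum_(m <- points n | (supp n m \subset S) && (T \subset large n m))
     (-1) ^+ #|T| : int).
  apply: eq_bigr => T TS.
  have expE i : ((- 'X) ^+ #|T| : {poly int})`_i = (-1) ^+ #|T| * (i == #|T|)%:R.
    by rewrite (exprNn (polyX _)) -signr_odd mulr_sign -signr_odd mulr_sign;
      case: odd; rewrite ?coefN coefXn.
  (* The power of [- 'X] is a monomial, so only the index [i = #|T|] contributes. If [#|T|] exceeds
     [n] both sides vanish: the index is out of range, and a point of height [n] has at most [n]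
     large coordinates. *)
  have [Tn|nT] := leqP #|T| n.
    rewrite (bigD1 (inord #|T|)) //= expE inordK // eqxx mulr1.
    rewrite [X in _ + X]big1 ?addr0 => [|i iT]; last first.
      rewrite expE; case: eqP => [iE|]; last by rewrite mulr0 mul0r.
      by case/eqP: iT; apply/val_inj; rewrite /= inordK.
    rewrite (@sum_points_shift S T (n - #|T|)%N n) ?subnK //.
    by rewrite natr_sum mulr_sumr; apply: eq_bigr => m _; rewrite mulr1.
  rewrite !big1_seq //= => [m|i _].
    rewrite in_points => /andP[/andP[_ Tm] /asboolP /card_large].
    by move=> /(leq_trans (subset_leq_card Tm)); rewrite leqNgt nT.
  rewrite expE; case: eqP => [iE|]; last by rewrite mulr0 mul0r.
  by have := ltn_ord i; rewrite iE ltnS leqNgt nT.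
(* For a fixed point the signs over subsets of [large n m] cancel unless that set is empty. *)
rewrite /box (exchange_big_dep (fun m => supp n m \subset S)) /=; last first.
  by move=> T m _ /andP[].
rewrite [RHS]big_mkcondr /=; apply: eq_bigr => m mS.
rewrite (eq_bigl (fun T : {set _} => T \subset large n m)) => [|T].
  by rewrite sum_sign_subset; case: eqP.
rewrite mS /=; apply: andb_idl => Tm.
exact: fintype.subset_trans Tm (fintype.subset_trans (large_sub_supp _ _) mS).
Qed.

(** The sum of [d.+1] coordinates below 1 is below [d.+1]. This bound makes the generating series of
    [box] a polynomial. *)
Lemma box_ge (S : {set 'I_d.+1}) n : (d < n)%N -> box S n = 0.
Proof.
move=> dn; rewrite /box big1_seq // => m.
rewrite in_points => /andP[/andP[_ /eqP m0] /asboolP/dilate_coef[_ [sc _]]].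
have : \sum_i coef n m i < \sum_(i < d.+1) 1.
  apply: ltr_sum => [|i _]; first by apply/hasP; exists ord0; rewrite ?mem_index_enum.
  by rewrite ltNge; have := finset.in_set0 i; rewrite -m0 inE => ->.
by rewrite sc sumr_const card_ord ltr_nat ltnS leqNgt dn.
Qed.

(** Only the origin has empty support, so the box count agrees with the convention that the empty
    face has polynomial 1. *)
Lemma box0 n : box finset.set0 n = (n == 0)%:R.
Proof.
rewrite /box.
have supp0 m : dilate n m -> supp n m \subset finset.set0 -> n = 0.
  move=> /dilate_coef[_ [sc _]]; rewrite finset.subset0 => /eqP s0.
  apply/eqP; rewrite -(@pnatr_eq0 R) -sc big1 // => i _; apply/eqP.
  by have := finset.in_set0 i; rewrite -s0 inE => /negbFE.
have [n0|n0] := eqVneq n 0; last first.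
  rewrite big1_seq // => m; rewrite in_points => /andP[/andP[sm _] /asboolP Dm].
  by rewrite (supp0 m) ?eqxx in n0.
have b0 : barycentric (fun=> 0) n 0.
  by split; rewrite ?n0 ?realpt0 big1 // => i _; rewrite scale0r.
have -> : points n = [fset 0]%fset.
  apply/fsetP => m; rewrite in_points in_fset1; apply/asboolP/eqP => [|->].
    move=> /dilate_coef[c0 cm].
    apply: (barycentric_pt_inj _ b0); suff <- : coef n m = fun=> 0 by [].
    apply/funext => i; apply/eqP; move: cm.1 => /eqP.
    rewrite [in X in _ == X]n0 psumr_eq0 //.
    by move=> /allP/(_ i (mem_index_enum _)).
  by exists (fun=> 0); split.
rewrite big_mkcond /= big_seq_fset1.
have -> : supp n 0 = finset.set0.
  by apply/setP => i; rewrite !inE (coefE b0) eqxx.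
have -> : large n 0 = finset.set0.
  by apply/setP => i; rewrite !inE (coefE b0) ler10.
by rewrite finset.sub0set eqxx.
Qed.

Lemma hstar_face_coef (S : {set 'I_d.+1}) n :
  (hstar_face R phi v S)`_n = box S n.
Proof.
rewrite /hstar_face; case: ifPn => [|S0].
  by rewrite cards_eq0 => /eqP ->; rewrite box0 coef1.
rewrite -lt0n in S0.
(* The polynomial [h] shows that the defining condition of [hstar_nonempty] can be met, which rules
   out the default value of [xget]. The condition fixes all coefficients, so whichever polynomial is
   chosen has those of [box]. *)
pose h : {poly int} := \poly_(k < d.+1) box S k.
have hE k : h`_k = box S k.
  by rewrite coef_poly ltnS; case: leqP => // /box_ge ->.
rewrite /hstar_nonempty; case: xgetP => [_ -> ->|/(_ h)]; first by rewrite hstar_coef.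
by case=> k; rewrite hE hstar_coef.
Qed.

(** After exchanging the sums, each box point is weighted by the signs over all [S] containing its
    support. They cancel unless the support is full. *)
Lemma local_hstar_coef n : (local_hstar R phi v)`_n =
  \sum_(m <- points n | (supp n m == [set: _]%SET) && (large n m == finset.set0)) 1.
Proof.
rewrite /local_hstar coef_sum.
transitivity (\sum_(S : {set 'I_d.+1})
   \sum_(m <- points n | (large n m == finset.set0) && (supp n m \subset S))
     (-1) ^+ (d.+1 - #|S|) : int).
  apply: eq_bigr => S _.
  rewrite -(rmorph_sign polyC) coefCM hstar_face_coef /box mulr_sumr.
  by apply: eq_big => [m|m _]; rewrite ?mulr1 // andbC.
rewrite (exchange_big_dep (fun m => large n m == finset.set0)) /=; last first.
  by move=> S m _ /andP[].
under [RHS]eq_bigl do rewrite andbC.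
rewrite [RHS]big_mkcondr /=; apply: eq_bigr => m mS.
under eq_bigl do rewrite mS.
have := sum_sign_superset (supp n m); rewrite card_ord => ->.
by case: eqP.
Qed.

Definition open_box_point (a : 'I_d.+1 -> R) : Prop :=
  (forall i, 0 < a i < 1) /\ exists n m, barycentric a n m.

(** Each coefficient is a sum of ones over the open box points of its height, so it vanishes only if
    there are none. *)
Lemma thin_simplexP : thin_simplex R phi v <-> ~ exists a, open_box_point a.
Proof.
split=> [thin [a [a01 [n [m am]]]]|nobox].
  have : (local_hstar R phi v)`_n = 0 by rewrite thin coef0.
  have mn : m \in points n.
    rewrite in_points; apply/asboolP; exists a; split=> // i.
    by have /andP[/ltW] := a01 i.
  rewrite local_hstar_coef => /eqP; rewrite psumr_eq0 // => /allP/(_ m mn).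
  suff [-> ->] : supp n m = [set: _]%SET /\ large n m = finset.set0.
    by rewrite !eqxx oner_eq0.
  split; apply/setP => i; have /andP[a0 a1] := a01 i; rewrite !inE (coefE am).
    by rewrite gt_eqF.
  by rewrite leNgt a1.
apply/polyP => n; rewrite coef0 local_hstar_coef big1_seq // => m.
rewrite in_points => /andP[/andP[/eqP sm /eqP lm] /asboolP/dilate_coef[c0 cm]].
case: nobox; exists (coef n m); split; last by exists n, m.
move=> i; have := finset.in_setT i; have := finset.in_set0 i.
rewrite -{1}lm -sm !inE => l1 n0.
by rewrite lt_neqAle eq_sym n0 c0 ltNge l1.
Qed.

(** * The group of coordinates of points of the lattice [M] plus [Z] *)

Definition integral (a : 'I_d.+1 -> R) : Prop :=
  exists (m : M) (k : int), \sum_i a i = k%:~R /\ \sum_i a i *: pt (v i) = pt m.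

Lemma integralD a b : integral a -> integral b -> integral (fun i => a i + b i).
Proof.
move=> [m [k [sa pa]]] [m' [k' [sb pb]]]; exists (m + m'), (k + k'); split.
  by rewrite big_split /= sa sb intrD.
by under eq_bigr do rewrite scalerDl; rewrite big_split /= pa pb realptD.
Qed.

Lemma integral_int (z : 'I_d.+1 -> int) : integral (fun i => (z i)%:~R).
Proof.
exists (\sum_i v i *~ z i), (\sum_i z i); split; first by rewrite rmorph_sum.
by rewrite realpt_sum; apply: eq_bigr => i _; rewrite realptMz.
Qed.

Lemma integral_natmul a n : integral a -> integral (fun i => n%:R * a i).
Proof.
move=> ia; elim: n => [|n IH].
  by under eq_fun do rewrite mul0r; exact: integral_int (fun=> 0).
by under eq_fun do rewrite mulrSr mulrDl mul1r; exact: integralD.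
Qed.

Lemma integral_frac a : integral (fun i => frac_part (a i)) <-> integral a.
Proof.
split=> ia.
  have -> : a = fun i => frac_part (a i) + (Num.floor (a i))%:~R.
    by apply/funext => i; rewrite subrK.
  exact: integralD ia (integral_int _).
have -> : (fun i => frac_part (a i)) = fun i => a i + (- Num.floor (a i))%:~R.
  by apply/funext => i; rewrite intrN.
exact: integralD ia (integral_int _).
Qed.

(** Passing to fractional parts subtracts an integer combination of lifted vertices, so it does not
    affect integrality. *)
Lemma Lambda_integral (x : 'I_d.+1 -> R) : Lambda phi v x <-> integral x.
Proof.
rewrite -integral_frac.
have liftE (a : 'I_d.+1 -> R) : \sum_i a i *: lift_pt R phi (v i) 1 =
    row_mx (\sum_i a i *: pt (v i)) (const_mx (\sum_i a i)).
  apply/rowP => j; rewrite summxE; case: (split_ordP j) => k ->.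
    by rewrite row_mxEl summxE; apply: eq_bigr => i _; rewrite mxE [RHS]mxE row_mxEl.
  by rewrite row_mxEr mxE; apply: eq_bigr => i _; rewrite mxE row_mxEr mxE mulr1.
split=> -[m [k]].
  rewrite liftE => /eq_row_mx[pm /rowP/(_ 0)]; rewrite !mxE => sk.
  by exists m, k.
by move=> [sk pm]; exists m, k; rewrite liftE sk pm.
Qed.

Lemma frac_part_itv (x : R) : 0 <= frac_part x < 1.
Proof. by rewrite subr_ge0 floor_le ltrBlDr addrC -(intrD _ _ 1) floorD1_gt. Qed.

Lemma frac_partE (x y : R) (z : int) :
  x = y + z%:~R -> 0 <= y < 1 -> frac_part x = y.
Proof.
move=> -> y01; rewrite /frac_part floorDrz ?intr_int // intrKfloor.
have /eqP -> : Num.floor y == 0 by rewrite floor_eq add0r.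
by rewrite add0r addrK.
Qed.

(** * Finiteness of the half-open box, rationality and denominators *)

Definition box_points : set ('I_d.+1 -> R) :=
  [set a | (forall i, 0 <= a i < 1) /\ integral a].

(** The height is an integer from 0 to [d], so finitely many finite dilates cover the box. *)
Lemma finite_box_points : finite_set box_points.
Proof.
apply: (@sub_finite_set _ _ (\bigcup_(n in `I_d.+1) (coef n @` dilate n))).
  move=> a [a01 [m [k [sk pm]]]].
  have k0 : 0 <= k.
    by rewrite -(ler_int R) -sk sumr_ge0 // => i _; case/andP: (a01 i).
  have kd : k < d.+1%:Z.
    rewrite -(ltr_int R) -sk -pmulrn -[d.+1 in ltRHS]card_ord -sumr_const.
    apply: ltr_sum => [|i _]; last by case/andP: (a01 i).
    by apply/hasP; exists ord0; rewrite ?mem_index_enum.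
  case: k k0 kd sk => // n _ nd sn.
  have am : barycentric a n m by [].
  exists n => //; exists m; last exact: coefE.
  by exists a; split=> // i; case/andP: (a01 i).
apply: bigcup_finite => [|n _]; first exact: finite_II.
exact/finite_image/finite_dilate.
Qed.

(* Finiteness of the half-open box makes two multiples of x congruent. *)
Lemma integral_torsion x : integral x ->
  exists2 n : nat, (0 < n)%N & forall i, exists z : int, n%:R * x i = z%:~R.
Proof.
move=> ix; pose f (n : nat) i := frac_part (n%:R * x i).
pose B := fset_set box_points.
have : ~~ uniq (map f (iota 0 (size B).+1)).
  apply/negP => /uniq_leq_size/(_ (_ : {subset _ <= (B : seq _)})).
  rewrite size_map size_iota ltnn => H; apply/notF/H => _ /mapP[n _ ->].
  rewrite in_fset_set; last exact: finite_box_points.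
  rewrite inE; split=> [i|]; first exact: frac_part_itv.
  exact/integral_frac/integral_natmul.
case/(uniqPn (f 0))=> i [j [ij]]; rewrite size_map size_iota => jB.
rewrite !(nth_map 0) ?size_iota ?(ltn_trans ij) // !nth_iota ?(ltn_trans ij) // !add0n.
move=> fij; exists (j - i)%N; rewrite ?subn_gt0 // => l.
exists (Num.floor (j%:R * x l) - Num.floor (i%:R * x l)).
have := congr1 (fun g => g l) fij.
by rewrite /f /frac_part natrB 1?ltnW // mulrBl intrB; lra.
Qed.

Lemma Lambda_rat (x : 'I_d.+1 -> R) i :
  Lambda phi v x -> exists q : rat, frac_part (x i) = ratr q.
Proof.
move=> /Lambda_integral/integral_frac/integral_torsion[n n0 /(_ i)[z nz]].
exists (z%:~R / n%:R); rewrite fmorph_div rmorph_int rmorph_nat -nz mulrC mulKf //.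
by rewrite pnatr_eq0 -lt0n.
Qed.

(** Needed because [fset_set] gives the empty set on an infinite set, which would make [N_simplex]
    meaningless. A real is the image of at most one rational, so [g] recovers each denominator from
    a box point and an index. *)
Lemma finite_denominators : finite_set (denominators R phi v).
Proof.
pose g (ai : ('I_d.+1 -> R) * 'I_d.+1) :=
  absz (denq (xget 0 [set q | ai.1 ai.2 = ratr q])).
apply: (@sub_finite_set _ _ (g @` (box_points `*` [set: 'I_d.+1]))).
  move=> n [x [/Lambda_integral/integral_frac ix [i [q [xq ->]]]]].
  exists (fun i => frac_part (x i), i).
    by split=> //; split=> // j; exact: frac_part_itv.
  rewrite /g /=; congr (absz (denq _)); apply: xget_unique => // q'.
  by rewrite /= xq => /fmorph_inj ->.
apply/finite_image/finite_setX; first exact: finite_box_points.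
exact: finite_finset.
Qed.

(** * The modulus [N] and the code *)

Local Notation N := (N_simplex R phi v).

Lemma N_simplex_gt0 : (0 < N)%N.
Proof.
rewrite /N_simplex big_seq; elim/big_ind: _ => // [m n|n].
  by rewrite lcmn_gt0 => -> ->.
rewrite in_fset_set; last exact: finite_denominators.
by rewrite inE => -[x [_ [i [q [_ ->]]]]]; rewrite absz_gt0 denq_neq0.
Qed.

Lemma denominators_dvd n : denominators R phi v n -> (n %| N)%N.
Proof.
rewrite /N_simplex => Dn; set D := fset_set _.
have : n \in enum_fset D.
  suff : n \in D by [].
  by rewrite in_fset_set ?inE //; exact: finite_denominators.
elim: (enum_fset D) => // m s IH.
rewrite inE big_cons => /orP[/eqP ->|/IH]; first exact: dvdn_lcml.
by move=> /dvdn_trans; apply; exact: dvdn_lcmr.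
Qed.

(** The denominator of each fractional part divides [N], so multiplication by [N] yields an integer
    in [[0, N)]. *)
Lemma Lambda_word (x : 'I_d.+1 -> R) : Lambda phi v x ->
  exists w : 'rV['I_N.-1.+1]_d.+1, forall i, (w 0 i : nat)%:R = N%:R * frac_part (x i).
Proof.
move=> Lx.
have wi i : exists c : 'I_N.-1.+1, (c : nat)%:R = N%:R * frac_part (x i).
  have [q xq] := Lambda_rat i Lx.
  have /dvdnP[c Nc] : (absz (denq q) %| N)%N.
    by apply: denominators_dvd; exists x; split=> //; exists i, q.
  have /andP[x0 x1] := frac_part_itv (x i).
  have NE : N%:R * frac_part (x i) = (c%:Z * numq q)%:~R.
    rewrite xq {1}Nc natrM /ratr mulrACA.
    rewrite [X in _ * (X)](_ : _ = 1) ?mulr1 ?intrM //.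
    have -> : (absz (denq q))%:R = (denq q)%:~R :> R by rewrite pmulrn absz_denq.
    by rewrite divff // intr_eq0 denq_neq0.
  have c0 : 0 <= c%:Z * numq q by rewrite -(ler_int R) -NE mulr_ge0.
  have cN : (absz (c%:Z * numq q)%R < N.-1.+1)%N.
    rewrite prednK ?N_simplex_gt0 // -(ltr_nat R) pmulrn gez0_abs // -NE.
    by rewrite gtr_pMr // ltr0n N_simplex_gt0.
  by exists (Ordinal cN); rewrite NE /= pmulrn gez0_abs.
have /choice[w wE] := wi; exists (\row_i w i) => i.
by rewrite mxE.
Qed.

(** Reduction modulo [N] in the code corresponds to reduction modulo 1 in [Lambda]. *)
Lemma modn_frac_part (c : nat) (t : R) (z : int) :
  c%:R = N%:R * (t - z%:~R) -> (c %% N)%:R = N%:R * frac_part t.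
Proof.
have N0 : 0 < N%:R :> R by rewrite ltr0n N_simplex_gt0.
(* Dividing [c] by [N] with remainder gives [t] as remainder over [N], plus the quotient, plus
   [z]. *)
move=> cE; rewrite (@frac_partE t ((c %% N)%:R / N%:R) (z + (c %/ N)%:Z)).
- by rewrite mulrC divfK // gt_eqF.
- move: cE; rewrite {1}(divn_eq c N) natrD natrM intrD -pmulrn => cE.
  apply: (mulfI (lt0r_neq0 N0)); rewrite mulrDr mulrCA divff ?mulr1 ?gt_eqF //.
  by move: cE; rewrite mulrBr => /eqP; rewrite -subr_eq opprK => /eqP <-;
    rewrite mulrDr; ring.
- by rewrite divr_ge0 // ltr_pdivrMr // mul1r ltr_nat ltn_mod N_simplex_gt0.
Qed.

Lemma code_simplex_linear : linear_code (code_simplex R phi v).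
Proof.
have C0 : code_simplex R phi v 0.
  exists (fun=> 0); split; first by apply/Lambda_integral; exact: integral_int (fun=> 0).
  by move=> i; rewrite mxE /= (@frac_partE 0 0 0) ?addr0 ?mulr0 // lexx ltr01.
have CD u w : code_simplex R phi v u -> code_simplex R phi v w ->
    code_simplex R phi v (u + w).
  move=> [x [/Lambda_integral ix xu]] [y [/Lambda_integral iy yw]].
  exists (fun i => x i + y i); split; first exact/Lambda_integral/integralD.
  move=> i; rewrite mxE /= [X in (_ %% X)%N](prednK N_simplex_gt0).
  apply: (@modn_frac_part _ _ (Num.floor (x i) + Num.floor (y i))).
  by rewrite natrD xu yw -mulrDr intrD addrACA -opprD.
split=> // a u Cu; elim: (a : nat) => [|n IH]; first by rewrite mulr0n.
by rewrite mulrS; exact: CD.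
Qed.

(** The entries of a word add up to [N] times the integral height of the lattice point. *)
Lemma code_simplex_extended : extended_code (code_simplex R phi v).
Proof.
move=> w [x [/Lambda_integral/integral_frac[m [k [sk _]]] xw]]; apply: val_inj.
have -> : val (\sum_i w 0 i) = ((\sum_i (w 0%R i : nat)) %% N)%N.
  elim/big_rec2: _ => [|i n s _ /= ->]; first by rewrite mod0n.
  by rewrite [X in (_ %% X)%N](prednK N_simplex_gt0) modnDmr.
have sN : (\sum_i (w 0%R i : nat))%:Z = N%:Z * k.
  apply: (@intr_inj R); rewrite -pmulrn natr_sum intrM -sk -pmulrn mulr_sumr.
  exact: eq_bigr.
by have := congr1 absz sN; rewrite abszM /= => ->; rewrite modnMr.
Qed.

(** Dividing by [N] sends full words to open box points. Conversely, a point of the open box is its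
    own fractional part, hence gives a word with nonzero entries. *)
Lemma full_wordP :
  has_full_word (code_simplex R phi v) <-> exists a, open_box_point a.
Proof.
split=> [[w [[x [Lx xw]] w0]]|[a [a01 [n [m am]]]]].
  exists (fun i => frac_part (x i)).
  have x01 i : 0 < frac_part (x i) < 1.
    have /andP[x0 ->] := frac_part_itv (x i); rewrite andbT lt_neqAle x0 andbT.
    apply: contraNneq (w0 i) => xi0; apply/eqP/val_inj/eqP => /=.
    by rewrite -(pnatr_eq0 R) xw -xi0 mulr0.
  split=> //; have /Lambda_integral/integral_frac[m [k [sk pm]]] := Lx.
  (* [integral] allows any integer height, whereas [barycentric] needs a natural number. *)
  have k0 : 0 <= k.
    by rewrite -(ler_int R) -sk sumr_ge0 // => i _; case/andP: (x01 i) => /ltW.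
  by case: k k0 sk => // n _ sn; exists n, m.
have La : Lambda phi v a by apply/Lambda_integral; case: am => sa pa; exists m, n%:Z.
have [w wE] := Lambda_word La; exists w; split; first by exists a.
move=> i; apply/eqP => wi; have /andP[a0 a1] := a01 i.
have := wE i; rewrite wi /= (@frac_partE (a i) (a i) 0) ?addr0 ?(ltW a0) //.
by apply/eqP; rewrite eq_sym mulf_neq0 ?gt_eqF // ltr0n N_simplex_gt0.
Qed.

End SimplexPoints.

Theorem corollary2p7 (R : realType) (d : nat) (M : zmodType)
    (phi : {additive M -> 'rV[int]_d}) (phi_bij : bijective phi)
    (v : 'I_d.+1 -> M)
    (v_simplex : affinely_independent (fun i => realpt R phi (v i))) :
  (thin_simplex R phi v <-> thin_code (code_simplex R phi v)) /\
  (thin_simplex R phi v <->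
     ~ exists w, code_simplex R phi v w /\ forall i, w 0 i != 0).
Proof.
have thinE : thin_simplex R phi v <-> ~ has_full_word (code_simplex R phi v).
  by rewrite thin_simplexP // full_wordP.
split=> //; rewrite thinE; split=> [nofull|[]//].
split=> //; [exact: code_simplex_linear|exact: code_simplex_extended].
Qed.
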